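(* (Constructively.) For a countable signature, let $\mathcal M$ be a model admitting a blurred Henkin environment $\rho:\mathbb N\to\mathcal M$. Then there is a model $\mathcal N$ whose domain is the (countable) type $\mathbb T$ of terms, together with an elementary embedding $\mathcal N\to\mathcal M$.
   Context: First-order logic without equality over a signature with countably many function and relation symbols; variables are de Bruijn indices $\mathsf x_n$, terms $\mathbb T$, formulas built from $\dot\bot$, atoms, $\dot\to,\dot\land,\dot\lor,\dot\forall,\dot\exists$ (a quantifier binds index $0$). A model is a type with interpretations of symbols; $\mathcal M\vDash_\rho\phi$ is Tarski satisfaction for $\rho:\mathbb N\to\mathcal M$, and $\mathcal M\vDash_\rho\phi[a]$ means satisfaction in the environment $\mathsf x_0\mapsto a$, $\mathsf x_{k+1}\mapsto\rho\,k$. An environment $\rho$ is a blurred Henkin environment if for every formula $\phi$: $(\forall n.\,\mathcal M\vDash_\rho\phi[\rho\,n])\to\mathcal M\vDash_\rho\dot\forall\phi$, and $\mathcal M\vDash_\rho\dot\exists\phi\to\exists n.\,\mathcal M\vDash_\rho\phi[\rho\,n]$. A map $h:\mathcal N\to\mathcal M$ is an elementary embedding if for all $\sigma:\mathbb N\to\mathcal N$ and formulas $\phi$, $\mathcal N\vDash_\sigma\phi\leftrightarrow\mathcal M\vDash_{h\circ\sigma}\phi$. *)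

(* Defs.v *)
(* Vanilla Stdlib development: first-order logic without equality, with
   de Bruijn variables and vectors of arguments. *)
From Stdlib Require Import Vector.

Set Implicit Arguments.
Unset Strict Implicit.

(* Countability as enumerability; values in [option] so that empty types
   (e.g. no function symbols) are included. *)
Definition enumerable (X : Type) : Prop :=
  exists e : nat -> option X, forall x : X, exists n : nat, e n = Some x.

Record signature : Type := Signature {
  func : Type;
  func_ar : func -> nat;
  rel : Type;
  rel_ar : rel -> nat
}.

Definition countable_signature (Sig : signature) : Prop :=
  enumerable (func Sig) /\ enumerable (rel Sig).

Inductive term (Sig : signature) : Type :=
| Var : nat -> term Sig
| App : forall f : func Sig, Vector.t (term Sig) (func_ar f) -> term Sig.

Arguments Var {Sig} n.
Arguments App {Sig} f v.

(* [All] and [Ex] bind the variable of index 0. *)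
Inductive form (Sig : signature) : Type :=
| Bot : form Sig
| Atom : forall P : rel Sig, Vector.t (term Sig) (rel_ar P) -> form Sig
| Imp : form Sig -> form Sig -> form Sig
| And : form Sig -> form Sig -> form Sig
| Or : form Sig -> form Sig -> form Sig
| All : form Sig -> form Sig
| Ex : form Sig -> form Sig.

Arguments Bot {Sig}.
Arguments Atom {Sig} P v.

(* A model with domain [D]. *)
Record model (Sig : signature) (D : Type) : Type := Model {
  i_func : forall f : func Sig, Vector.t D (func_ar f) -> D;
  i_rel : forall P : rel Sig, Vector.t D (rel_ar P) -> Prop
}.

(* The environment x_0 |-> a, x_(k+1) |-> rho k. *)
Definition scons (D : Type) (a : D) (rho : nat -> D) (n : nat) : D :=
  match n with
  | 0 => a
  | S k => rho k
  end.

Section Semantics.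

Context (Sig : signature) (D : Type) (M : model Sig D).

Fixpoint eval (rho : nat -> D) (t : term Sig) : D :=
  match t with
  | Var n => rho n
  | App f v => i_func M (Vector.map (eval rho) v)
  end.

Fixpoint sat (rho : nat -> D) (phi : form Sig) : Prop :=
  match phi with
  | Bot => False
  | Atom P v => i_rel M (Vector.map (eval rho) v)
  | Imp phi psi => sat rho phi -> sat rho psi
  | And phi psi => sat rho phi /\ sat rho psi
  | Or phi psi => sat rho phi \/ sat rho psi
  | All phi => forall a : D, sat (scons a rho) phi
  | Ex phi => exists a : D, sat (scons a rho) phi
  end.

Definition blurred_henkin (rho : nat -> D) : Prop :=
  forall phi : form Sig,
    ((forall n : nat, sat (scons (rho n) rho) phi) -> sat rho (All phi)) /\
    (sat rho (Ex phi) -> exists n : nat, sat (scons (rho n) rho) phi).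

End Semantics.

Definition elementary_embedding (Sig : signature) (DN DM : Type)
    (N : model Sig DN) (M : model Sig DM) (h : DN -> DM) : Prop :=
  forall (sigma : nat -> DN) (phi : form Sig),
    sat N sigma phi <-> sat M (fun n => h (sigma n)) phi.

(* Main.v *)
(* Evaluation under the blurred Henkin environment [rho] is the embedding, and
   the relation symbols of the term model are interpreted by pullback along it.
   In a quantifier step, an environment of terms is a substitution [sigma], so
   the body under [eval M rho] composed with [sigma] is the substituted body
   under [rho]. The Henkin property of [rho] then reduces quantification over
   [D] to the elements [rho n = eval M rho (Var n)], which are values of terms. *)
From Stdlib Require Import Arith Cantor Lia.
From Stdlib Require Vector.
Require Import Defs.

Set Implicit Arguments.
Unset Strict Implicit.

(* The automatically generated principle has no hypothesis for the arguments. *)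
Lemma term_nested_ind (Sig : signature) (P : term Sig -> Prop)
  (HVar : forall n, P (Var n))
  (HApp : forall f v, Vector.Forall P v -> P (App f v)) :
  forall t, P t.
Proof.
  fix IH 1. intros [n | f v].
  - apply HVar.
  - apply HApp. induction v as [| t m v IHv]; constructor.
    + apply IH.
    + exact IHv.
Qed.

Lemma vector_map_ext_Forall (A B : Type) (f g : A -> B) (n : nat)
  (v : Vector.t A n) :
  Vector.Forall (fun x => f x = g x) v -> Vector.map f v = Vector.map g v.
Proof.
  induction 1 as [| m x v Hx _ IH]; cbn; congruence.
Qed.

(** * Coding terms by natural numbers *)

Section Enumeration.

(** The length is not part of the code: in a term it is the arity of the symbol already decoded. *)
Fixpoint decode_vector (X : Type) (g : nat -> option X) (m c : nat) :
  option (Vector.t X m) :=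
  match m with
  | 0 => Some (Vector.nil X)
  | S m =>
      let (a, b) := Cantor.of_nat c in
      match g a, decode_vector g m b with
      | Some x, Some v => Some (Vector.cons X x m v)
      | _, _ => None
      end
  end.

(* The fuel [k] bounds the depth of the decoded term. *)
Fixpoint decode_term (Sig : signature) (e : nat -> option (func Sig))
  (k c : nat) : option (term Sig) :=
  match k with
  | 0 => None
  | S k =>
      let (a, b) := Cantor.of_nat c in
      match a with
      | 0 => Some (Var b)
      | S a =>
          match e a with
          | None => None
          | Some f =>
              option_map (App f)
                (decode_vector (decode_term e k) (func_ar f) b)
          end
      end
  end.

(** Each entry comes with its own fuel threshold. Asking for success at every larger fuel lets
    finitely many thresholds be merged by [max]. *)
Lemma decode_vector_surj (X : Type) (g : nat -> nat -> option X) (m : nat)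
  (v : Vector.t X m) :
  Vector.Forall (fun x => exists k c, forall k', k <= k' -> g k' c = Some x) v ->
  exists k c, forall k', k <= k' -> decode_vector (g k') m c = Some v.
Proof.
  induction 1 as [| m x v (k1 & c1 & H1) _ (k2 & c2 & H2)].
  - exists 0, 0. reflexivity.
  - exists (max k1 k2), (Cantor.to_nat (c1, c2)). intros k' Hk'.
    cbn -[Cantor.of_nat Cantor.to_nat]. rewrite Cantor.cancel_of_to.
    rewrite H1, H2 by lia. reflexivity.
Qed.

Lemma decode_term_surj (Sig : signature) (e : nat -> option (func Sig))
  (He : forall f, exists n, e n = Some f) (t : term Sig) :
  exists k c, forall k', k <= k' -> decode_term e k' c = Some t.
Proof.
  induction t as [n | f v IH] using term_nested_ind.
  - exists 1, (Cantor.to_nat (0, n)). intros [| k'] Hk'; [lia |].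
    cbn -[Cantor.of_nat Cantor.to_nat]. rewrite Cantor.cancel_of_to. reflexivity.
  - destruct (decode_vector_surj IH) as (k & c & Hc).
    destruct (He f) as [a Ha].
    (* The tag is shifted because 0 marks variables; the additional unit of fuel pays for the head
       symbol. *)
    exists (S k), (Cantor.to_nat (S a, c)). intros [| k'] Hk'; [lia |].
    cbn -[Cantor.of_nat Cantor.to_nat]. rewrite Cantor.cancel_of_to, Ha.
    rewrite Hc by lia. reflexivity.
Qed.

Lemma enumerable_term (Sig : signature) :
  enumerable (func Sig) -> enumerable (term Sig).
Proof.
  intros [e He].
  (* No fixed fuel serves terms of every depth, so the index also carries the fuel. *)
  exists (fun n => let (k, c) := Cantor.of_nat n in decode_term e k c). intros t.
  destruct (decode_term_surj He t) as (k & c & Hc).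
  exists (Cantor.to_nat (k, c)). rewrite Cantor.cancel_of_to. auto.
Qed.

End Enumeration.

(** * Substitution and satisfaction *)

Section Substitution.

Context {Sig : signature}.

Fixpoint subst_term (s : nat -> term Sig) (t : term Sig) : term Sig :=
  match t with
  | Var n => s n
  | App f v => App f (Vector.map (subst_term s) v)
  end.

Definition up (s : nat -> term Sig) : nat -> term Sig :=
  scons (Var 0) (fun n => subst_term (fun k => Var (S k)) (s n)).

Fixpoint subst_form (s : nat -> term Sig) (phi : form Sig) : form Sig :=
  match phi with
  | Bot => Bot
  | Atom P v => Atom P (Vector.map (subst_term s) v)
  | Imp phi psi => Imp (subst_form s phi) (subst_form s psi)
  | And phi psi => And (subst_form s phi) (subst_form s psi)
  | Or phi psi => Or (subst_form s phi) (subst_form s psi)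
  | All phi => All (subst_form (up s) phi)
  | Ex phi => Ex (subst_form (up s) phi)
  end.

Context (D : Type) (M : model Sig D).

Lemma eval_subst (rho tau : nat -> D) (s : nat -> term Sig) (t : term Sig) :
  (forall n, eval M rho (s n) = tau n) ->
  eval M rho (subst_term s t) = eval M tau t.
Proof.
  intros H. induction t as [n | f v IH] using term_nested_ind; cbn.
  - apply H.
  - rewrite Vector.map_map. f_equal. apply vector_map_ext_Forall, IH.
Qed.

Lemma eval_up (a : D) (rho tau : nat -> D) (s : nat -> term Sig) :
  (forall n, eval M rho (s n) = tau n) ->
  forall n, eval M (scons a rho) (up s n) = scons a tau n.
Proof.
  intros H [| n]; cbn; [reflexivity |].
  rewrite <- H. now apply eval_subst.
Qed.

(* Relating [tau] to [s] pointwise avoids functional extensionality. *)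
Lemma sat_subst (phi : form Sig) (rho tau : nat -> D) (s : nat -> term Sig) :
  (forall n, eval M rho (s n) = tau n) ->
  sat M rho (subst_form s phi) <-> sat M tau phi.
Proof.
  revert rho tau s.
  induction phi as [| P v | phi IH1 psi IH2 | phi IH1 psi IH2 | phi IH1 psi IH2
                   | phi IH | phi IH]; intros rho tau s H; cbn.
  - reflexivity.
  - rewrite Vector.map_map.
    erewrite Vector.map_ext; [reflexivity |].
    intros t. now apply eval_subst.
  - now rewrite (IH1 _ _ _ H), (IH2 _ _ _ H).
  - now rewrite (IH1 _ _ _ H), (IH2 _ _ _ H).
  - now rewrite (IH1 _ _ _ H), (IH2 _ _ _ H).
  - split; intros Ha a; apply (IH _ _ _ (eval_up a H)), Ha.
  - split; intros [a Ha]; exists a; apply (IH _ _ _ (eval_up a H)), Ha.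
Qed.

Lemma sat_ext (phi : form Sig) (rho tau : nat -> D) :
  (forall n, rho n = tau n) -> sat M rho phi <-> sat M tau phi.
Proof.
  intros H.
  (* The identity substitution relates [rho] both to itself and to [tau], which saves a separate
     induction. *)
  rewrite <- (@sat_subst phi rho rho Var) by reflexivity.
  now apply sat_subst.
Qed.

(** * The model on terms and its embedding *)

Definition term_model (rho : nat -> D) : model Sig (term Sig) :=
  {| i_func := @App Sig;
     i_rel := fun P v => i_rel M (Vector.map (eval M rho) v) |}.

(** With [App] interpreting the function symbols, the two recursions are convertible. *)
Lemma eval_term_model (rho : nat -> D) (s : nat -> term Sig) (t : term Sig) :
  eval (term_model rho) s t = subst_term s t.
Proof.
  reflexivity.
Qed.

Lemma eval_scons_comp (rho : nat -> D) (s : nat -> term Sig) (t : term Sig) n :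
  eval M rho (scons t s n) =
  scons (eval M rho t) (fun k => eval M rho (s k)) n.
Proof.
  destruct n; reflexivity.
Qed.

Lemma term_model_elementary (rho : nat -> D) :
  blurred_henkin M rho ->
  elementary_embedding (term_model rho) M (eval M rho).
Proof.
  intros Hrho s phi. revert s.
  induction phi as [| P v | phi IH1 psi IH2 | phi IH1 psi IH2 | phi IH1 psi IH2
                   | phi IH | phi IH]; intros s; cbn.
  - reflexivity.
  - rewrite Vector.map_map.
    erewrite Vector.map_ext; [reflexivity |].
    intros t. rewrite eval_term_model. now apply eval_subst.
  - now rewrite IH1, IH2.
  - now rewrite IH1, IH2.
  - now rewrite IH1, IH2.
  (* The Henkin condition speaks of [rho] only, so [s] is absorbed into the formula. Since [a] need
     not be the value of a term, [up s] keeps index 0 free for it. *)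
  - assert (Hs : forall a, sat M (scons a rho) (subst_form (up s) phi) <->
                   sat M (scons a (fun n => eval M rho (s n))) phi).
    { intros a. now apply sat_subst, eval_up. }
    setoid_rewrite IH. split.
    + intros H a. apply Hs. revert a.
      (* The instances at [rho n] demanded here are the given ones at the terms [Var n]. *)
      apply (proj1 (Hrho (subst_form (up s) phi))). intros n. apply Hs.
      exact (proj1 (sat_ext _ (eval_scons_comp rho s (Var n))) (H (Var n))).
    + intros H t. apply (sat_ext _ (eval_scons_comp rho s t)), H.
  - assert (Hs : forall a, sat M (scons a rho) (subst_form (up s) phi) <->
                   sat M (scons a (fun n => eval M rho (s n))) phi).
    { intros a. now apply sat_subst, eval_up. }
    setoid_rewrite IH. split.
    + intros [t H]. exists (eval M rho t).
      apply (sat_ext _ (eval_scons_comp rho s t)), H.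
    + intros [a H].
      (* The witness [a], possibly not the value of any term, is traded for some [rho n], the value
         of [Var n]. *)
      destruct (proj2 (Hrho (subst_form (up s) phi))) as [n Hn].
      { exists a. now apply Hs. }
      exists (Var n). apply (sat_ext _ (eval_scons_comp rho s (Var n))).
      now apply Hs.
Qed.

End Substitution.

Theorem theorem6p2 (Sig : signature) (HSig : countable_signature Sig)
  (D : Type) (M : model Sig D) (rho : nat -> D) (Hrho : blurred_henkin M rho) :
  enumerable (term Sig) /\
  exists (N : model Sig (term Sig)) (h : term Sig -> D),
    elementary_embedding N M h.
Proof.
  split.
  - apply enumerable_term, HSig.
  - exists (term_model M rho), (eval M rho).
    now apply term_model_elementary.
Qed.
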